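(* There is a cubical graph of girth $8$ that is not layered.
   Context: The hypercube $Q_n$ is the graph with vertex set $\{A : A\subseteq [n]\}$ and edge set all pairs $\{A,B\}$ with $A\subseteq B$ and $|A|=|B|-1$. A graph is cubical if it is (isomorphic to) a subgraph of $Q_n$ for some $n$. The $k$th edge layer of $Q_n$ is the subgraph of $Q_n$ induced by $\binom{[n]}{k}\cup\binom{[n]}{k-1}$. A graph is layered if it is (isomorphic to) a subgraph of some edge layer of $Q_n$ for some $n$. The girth of a graph is the length of its shortest cycle. *)

(* Defs.v *)
From HB Require Import structures.
From mathcomp Require Import all_boot.

Set Implicit Arguments.
Unset Strict Implicit.
Unset Printing Implicit Defensive.

Record sgraph := SGraph {
  vertex :> finType;
  adj : rel vertex;
  adj_sym : symmetric adj;
  adj_irrefl : irreflexive adj }.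

Definition isomorphic (G H : sgraph) : Prop :=
  exists f : G -> H, bijective f /\ forall x y, adj (f x) (f y) = adj x y.

(* Not necessarily induced, not necessarily spanning. *)
Record subgraph (G : sgraph) := Subgraph {
  sub_verts : {set G};
  sub_adj : rel G;
  sub_adj_sym : symmetric sub_adj;
  sub_adjP : forall x y,
    sub_adj x y -> [/\ x \in sub_verts, y \in sub_verts & adj x y] }.

Section GraphOfSubgraph.
Variables (G : sgraph) (S : subgraph G).

Let sub_rel : rel {x : G | x \in sub_verts S} :=
  fun x y => sub_adj S (val x) (val y).

Fact sub_rel_sym : symmetric sub_rel.
Proof. by move=> x y; apply: sub_adj_sym. Qed.

Fact sub_rel_irrefl : irreflexive sub_rel.
Proof.
by move=> x; apply/negP => /(@sub_adjP _ S) [_ _]; rewrite adj_irrefl.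
Qed.

Definition graph_of_subgraph : sgraph := SGraph sub_rel_sym sub_rel_irrefl.

End GraphOfSubgraph.

Coercion graph_of_subgraph : subgraph >-> sgraph.

Section Induced.
Variables (G : sgraph) (A : {set G}).

Let induced_adj : rel G := fun x y => [&& x \in A, y \in A & adj x y].

Fact induced_adj_sym : symmetric induced_adj.
Proof. by move=> x y; rewrite /induced_adj adj_sym andbCA. Qed.

Fact induced_adjP x y :
  induced_adj x y -> [/\ x \in A, y \in A & adj x y].
Proof. by move/and3P. Qed.

Definition induced : subgraph G := Subgraph induced_adj_sym induced_adjP.

End Induced.

(* [cover_rel A B] is "A \subset B and |A| = |B| - 1", written without the
   truncated subtraction, which would create a loop at the empty set. *)
Definition cover_rel (n : nat) (A B : {set 'I_n}) : bool :=
  (A \subset B) && (#|B| == #|A|.+1).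

Definition cube_adj (n : nat) : rel {set 'I_n} :=
  fun A B => cover_rel A B || cover_rel B A.

Fact cube_adj_sym n : symmetric (@cube_adj n).
Proof. by move=> A B; rewrite /cube_adj orbC. Qed.

Fact cube_adj_irrefl n : irreflexive (@cube_adj n).
Proof.
by move=> A; rewrite /cube_adj orbb /cover_rel -[X in X == _]addn0 -addn1 eqn_add2l andbF.
Qed.

Definition hypercube (n : nat) : sgraph :=
  SGraph (@cube_adj_sym n) (@cube_adj_irrefl n).

Definition edge_layer (n k : nat) : subgraph (hypercube n) :=
  @induced (hypercube n) [set A : {set 'I_n} | (#|A| == k) || (#|A|.+1 == k)].

Definition cubical (G : sgraph) : Prop :=
  exists (n : nat) (S : subgraph (hypercube n)), isomorphic G S.

Definition layered (G : sgraph) : Prop :=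
  exists (n k : nat), 1 <= k <= n /\
    exists S : subgraph (edge_layer n k), isomorphic G S.

(* [ucycle] alone would also accept a single edge [:: x; y]. *)
Definition graph_cycle (G : sgraph) (c : seq G) : Prop :=
  2 < size c /\ ucycle (@adj G) c.

(* A relation rather than a function: an acyclic graph has no finite girth. *)
Definition has_girth (G : sgraph) (g : nat) : Prop :=
  (exists c : seq G, graph_cycle c /\ size c = g) /\
  (forall c : seq G, graph_cycle c -> g <= size c).

(* Main.v *)
Require Import Defs.
From mathcomp Require Import all_boot.

(** The witness is an 8-cycle [0, 1, ..., 7] together with two further paths of
    length 4, one joining the antipodal vertices [0] and [4], the other joining
    the antipodal vertices [1] and [5].  It has 14 vertices, it embeds in [Q_4],
    and its girth is 8.

    Call the element in which two adjacent sets differ the colour of the edge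
    between them.  Inside an edge layer, let [u] and [w] be joined by three
    paths of length 4 starting with distinct edges.  Then on each of these paths
    the first and the last edge have the same colour ([theta_color]).  Indeed,
    up to complementation [u] and [w] lie on the lower level.  A path
    [u, x1, x2, x3, w] then adds an element [b], removes one, adds one and
    removes [g]; either [b = g] and [w :\: u] has one element, or [b] is one of
    the two elements of [w :\: u] ([zigzag_color]).  The second possibility would
    have to hold on all three paths, which would give three distinct elements of
    a set of size 2.

    In the witness there are three such paths from [0] to [4] and three from [1]
    to [5].  If [E1], ..., [E8] are the successive edges of the 8-cycle, this
    gives the equalities of colours E1 = E4, E5 = E8, E2 = E5 and E1 = E6.  As
    consecutive edges have different colours, the colour of E2 occurs exactly on
    E2, E5 and E8.  This is impossible, since every colour occurs an even number
    of times around a closed walk of the hypercube. *)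

Set Implicit Arguments.
Unset Strict Implicit.
Unset Printing Implicit Defensive.

(** * Embeddings as injective homomorphisms *)

Lemma cubical_of_embedding (G : sgraph) n (f : G -> {set 'I_n}) :
  injective f -> (forall x y, adj x y -> cube_adj (f x) (f y)) -> cubical G.
Proof.
move=> f_inj f_adj.
pose r : rel (hypercube n) :=
  fun A B => [exists x, exists y, [&& f x == A, f y == B & adj x y]].
have r_sym : symmetric r.
  have r_imp A B : r A B -> r B A.
    case/existsP=> x /existsP[y /and3P[xA yB xy]].
    by apply/existsP; exists y; apply/existsP; exists x; rewrite xA yB adj_sym.
  by move=> A B; apply/idP/idP; apply: r_imp.
have rP A B : r A B -> [/\ A \in f @: G, B \in f @: G & @adj (hypercube n) A B].
  case/existsP=> x /existsP[y /and3P[/eqP<- /eqP<- xy]].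
  by rewrite !imset_f //; split=> //; apply: f_adj.
exists n, (@Subgraph (hypercube n) (f @: G) r r_sym rP).
have f_im x : f x \in f @: G by apply: imset_f.
pose g (x : G) : {A | A \in f @: G} := exist _ (f x) (f_im x).
have gE x y : r (f x) (f y) = adj x y.
  apply/existsP/idP => [[x' /existsP[y' /and3P[/eqP/f_inj-> /eqP/f_inj->]]]//|xy].
  by exists x; apply/existsP; exists y; rewrite !eqxx.
have fP (A : {A | A \in f @: G}) : exists x, f x == val A.
  by case/imsetP: (valP A) => x _ ->; exists x.
exists g; split; last by move=> x y; apply: gE.
exists (fun A => xchoose (fP A)) => [x|A].
  exact/f_inj/eqP/(xchooseP (fP (g x))).
exact/val_inj/eqP/(xchooseP (fP A)).
Qed.

(** Adjacency in the [k]th edge layer, as a relation on sets. *)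
Definition layer_adj n k : rel {set 'I_n} :=
  fun A B => [&& (#|A| == k) || (#|A|.+1 == k), (#|B| == k) || (#|B|.+1 == k)
               & cube_adj A B].

Lemma layered_embedding (G : sgraph) :
  layered G -> exists n k (f : G -> {set 'I_n}),
    injective f /\ (forall x y, adj x y -> layer_adj k (f x) (f y)).
Proof.
case=> n [k [_ [S [f [f_bij f_adj]]]]].
exists n, k, (fun x => val (val (f x))); split.
  by move=> x y /val_inj/val_inj/(bij_inj f_bij).
move=> x y; rewrite -f_adj => /(@sub_adjP _ S)[_ _].
by case/(@sub_adjP _ (edge_layer n k)); rewrite !inE => fx fy fxy; apply/and3P.
Qed.

(** * Colours of hypercube edges *)

Section Colours.
Variable n : nat.
Implicit Types A B C u w : {set 'I_n}.

(** The symmetric difference; for adjacent sets it is the singleton of the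
    colour of the edge. *)
Definition color A B : {set 'I_n} := [set c | (c \in A) (+) (c \in B)].

Lemma in_color c A B : (c \in color A B) = (c \in A) (+) (c \in B).
Proof. by rewrite inE. Qed.

Lemma colorC A B : color A B = color B A.
Proof. by apply/setP=> c; rewrite !in_color addbC. Qed.

Lemma color_setC A B : color (~: A) (~: B) = color A B.
Proof. by apply/setP=> c; rewrite !in_color !inE addbN addNb negbK. Qed.

Lemma color_inj A B C : color A B = color B C -> A = C.
Proof.
move=> /setP eqAC; apply/setP=> c; have := eqAC c; rewrite !in_color.
by do 3 case: (c \in _).
Qed.

Lemma cover_relP A B :
  reflect (exists2 b, b \notin A & B = b |: A) (cover_rel A B).
Proof.
apply: (iffP andP) => [[sAB /eqP cB]|[b bA ->]]; last first.
  by rewrite subsetUr cardsU1 bA.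
have /cards1P[b Db] : #|B :\: A| == 1.
  by rewrite cardsD (setIidPr sAB) cB subSnn.
have : b \in B :\: A by rewrite Db set11.
rewrite inE => /andP[bA bB]; exists b => //.
rewrite -Db; apply/setP=> c; rewrite !inE.
by case: (boolP (c \in A)) => [/(subsetP sAB)->|_]; rewrite ?orbF ?orbT.
Qed.

Lemma cover_rel_setC A B : cover_rel (~: A) (~: B) = cover_rel B A.
Proof.
rewrite /cover_rel setCS; case: (boolP (B \subset A)) => //= sBA.
have := cardsC A; have := cardsC B; have := subset_leq_card sBA.
move: #|A| #|B| #|~: A| #|~: B| #|'I_n| => a b a' b' m leba eB eA.
by rewrite -(eqn_add2l b) eB addnS -eA -addSn eqn_add2r eq_sym.
Qed.

Lemma color_cover A B b : b \notin A -> B = b |: A -> color A B = [set b].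
Proof.
by move=> bA ->; apply/setP=> c; rewrite !inE; case: eqP => [->|_]; rewrite ?(negPf bA) ?addbb.
Qed.

Lemma color_adj A B : cube_adj A B -> exists b, color A B = [set b].
Proof.
case/orP=> /cover_relP[b bN E]; exists b; last rewrite colorC;
  exact: color_cover bN E.
Qed.

(** Consecutive edges of a path have different colours. *)
Lemma color_consecutive A B C c :
  cube_adj A B -> cube_adj B C -> A != C ->
  c \in color A B -> c \notin color B C.
Proof.
move=> /color_adj[a ea] /color_adj[b eb] neAC; rewrite ea eb !inE => /eqP->.
apply: contraNN neAC => /eqP ab; apply/eqP/(@color_inj A B C).
by rewrite ea eb ab.
Qed.

(** * Paths of length 4 in an edge layer *)

(** A path of length 4 which starts and ends on the lower level. *)
Definition zigzag u x1 x2 x3 w :=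
  [&& cover_rel u x1, cover_rel x2 x1, cover_rel x2 x3, cover_rel w x3
    & uniq [:: u; x1; x2; x3; w]].

Lemma zigzag_color u x1 x2 x3 w : zigzag u x1 x2 x3 w ->
     #|w :\: u| = 1 /\ color u x1 = color x3 w
  \/ #|w :\: u| = 2 /\ color u x1 \subset w :\: u.
Proof.
case/and5P=> /cover_relP[b bu x1E] /cover_relP[c cx2 x1E'].
case/cover_relP=> d dx2 x3E /cover_relP[g gw x3E'].
rewrite /= !inE !negb_or => /and4P[/and4P[_ ux2 _ _] /and3P[_ x13 _] /andP[_ x2w] _].
rewrite (color_cover bu x1E) (colorC x3) (color_cover gw x3E').
(* Membership in the upper sets [x1] and [x3], each expressed in two ways. *)
have E1 i : (i == b) || (i \in u) = (i == c) || (i \in x2).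
  by have := congr1 (fun A : {set _} => i \in A) x1E'; rewrite x1E !inE.
have E3 i : (i == d) || (i \in x2) = (i == g) || (i \in w).
  by have := congr1 (fun A : {set _} => i \in A) x3E'; rewrite x3E !inE.
have bc : b != c.
  apply: contraNneq ux2 => bc; apply/eqP/setP=> i; have := E1 i.
  by rewrite -bc; case: eqP => [->|//]; rewrite (negPf bu) bc (negPf cx2).
have dg : d != g.
  apply: contraNneq x2w => dg; apply/eqP/setP=> i; have := E3 i.
  by rewrite -dg; case: eqP => [->|//]; rewrite (negPf dx2) dg (negPf gw).
have cd : c != d by apply: contraNneq x13 => cd; rewrite x1E' x3E cd.
have cu : c \in u by have := E1 c; rewrite eqxx eq_sym (negPf bc).
have bx2 : b \in x2 by have := E1 b; rewrite eqxx (negPf bc).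
have bd : b != d by apply: contraNneq dx2 => <-.
have du : d \notin u.
  by have := E1 d; rewrite (negPf dx2) ![d == _]eq_sym (negPf bd) (negPf cd) /= => ->.
have dw : d \in w by have := E3 d; rewrite eqxx (negPf dg).
have [bg|bg] := eqVneq b g; [left|right].
- split; last by rewrite bg.
  apply/eqP/cards1P; exists d; apply/setP=> i; rewrite !inE.
  have [->|id] := eqVneq i d; first by rewrite du dw.
  have := E1 i; have := E3 i; rewrite (negPf id) -bg.
  have [->|ib] := eqVneq i b; first by rewrite bg (negPf gw) andbF.
  by case: (i \in u) => //= ->; case: (i \in w); rewrite ?orbT.
- have bw : b \in w by have := E3 b; rewrite bx2 orbT (negPf bg).
  split; last by rewrite sub1set inE bu bw.
  apply/eqP/cards2P; exists b, d; split=> //; apply/setP=> i; rewrite !inE.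
  have [->|ib] := eqVneq i b; first by rewrite bu bw.
  have [->|id] := eqVneq i d; first by rewrite du dw.
  have := E1 i; have := E3 i; rewrite (negPf id) (negPf ib) /=.
  by case: (i \in u) => //= ->; case: (i \in w); rewrite ?orbT.
Qed.

Lemma zigzag_theta u w x1 x2 x3 y1 y2 y3 z1 z2 z3 :
  zigzag u x1 x2 x3 w -> zigzag u y1 y2 y3 w -> zigzag u z1 z2 z3 w ->
  uniq [:: x1; y1; z1] -> color u x1 = color x3 w.
Proof.
move=> zx zy zz; rewrite /= !inE negb_or andbT => /andP[/andP[xy xz] yz].
have [[//]|[c2 sx]] := zigzag_color zx.
have [[]|[_ sy]] := zigzag_color zy; first by rewrite c2.
have [[]|[_ sz]] := zigzag_color zz; first by rewrite c2.
case/and5P: zx sx => /cover_relP[a au xE] _ _ _ _.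
case/and5P: zy sy => /cover_relP[b bu yE] _ _ _ _.
case/and5P: zz sz => /cover_relP[c cu zE] _ _ _ _.
rewrite (color_cover au xE) (color_cover bu yE) (color_cover cu zE) !sub1set.
move=> cw bw aw.
have ab : a != b by apply: contraNneq xy => ab; rewrite xE yE ab.
have ac : a != c by apply: contraNneq xz => ac; rewrite xE zE ac.
have bc : b != c by apply: contraNneq yz => bc; rewrite yE zE bc.
(* [a], [b], [c] are distinct elements of the two-element set [w :\: u]. *)
have : [set a; b; c] \subset w :\: u.
  by apply/subsetP=> i; rewrite !inE => /orP[/orP[]|] /eqP->; move: cw bw aw; rewrite !inE.
move/subset_leq_card; rewrite c2 -setUA cardsU1 cards2 !inE negb_or ab ac bc.
by [].
Qed.

(** A path of length 4 in an edge layer. *)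
Definition layer_path4 k u x1 x2 x3 w :=
  path (@layer_adj n k) u [:: x1; x2; x3; w] && uniq [:: u; x1; x2; x3; w].

Lemma layer_adj_up k A B :
  layer_adj k A B -> #|A|.+1 = k -> cover_rel A B /\ #|B| = k.
Proof.
case/and3P=> _ lB /orP[AB|/andP[_ /eqP cA]] kA.
  by split=> //; case/andP: AB => _ /eqP->.
by move: lB; rewrite -kA cA !eqn_leq ltnNge leqnSn !ltnn !andbF.
Qed.

Lemma layer_adj_down k A B :
  layer_adj k A B -> #|A| = k -> cover_rel B A /\ #|B|.+1 = k.
Proof.
case/and3P=> _ lB /orP[/andP[_ /eqP cB]|BA] kA.
  by move: lB; rewrite -kA cB !eqn_leq !ltnn [_.+2 <= _]ltnNge leqnSn.
by split=> //; case/andP: BA => _ /eqP<-.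
Qed.

Lemma layer_path4_low k u x1 x2 x3 w :
  layer_path4 k u x1 x2 x3 w -> #|u|.+1 = k -> zigzag u x1 x2 x3 w.
Proof.
case/andP=> /= /and5P[a1 a2 a3 a4 _] U ku.
have [c1 k1] := layer_adj_up a1 ku; have [c2 k2] := layer_adj_down a2 k1.
have [c3 k3] := layer_adj_up a3 k2; have [c4 _] := layer_adj_down a4 k3.
by rewrite /zigzag c1 c2 c3 c4.
Qed.

Lemma layer_path4_high k u x1 x2 x3 w :
  layer_path4 k u x1 x2 x3 w -> #|u| = k ->
  zigzag (~: u) (~: x1) (~: x2) (~: x3) (~: w).
Proof.
case/andP=> /= /and5P[a1 a2 a3 a4 _] U ku.
have [c1 k1] := layer_adj_down a1 ku; have [c2 k2] := layer_adj_up a2 k1.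
have [c3 k3] := layer_adj_down a3 k2; have [c4 _] := layer_adj_up a4 k3.
rewrite /zigzag !cover_rel_setC c1 c2 c3 c4.
by rewrite -(map_inj_uniq (@setC_inj _)) /= !setCK.
Qed.

(** In an edge layer, three paths of length 4 with common ends force the first
    and the last edge of each path to have the same colour. *)
Lemma theta_color k u w x1 x2 x3 y1 y2 y3 z1 z2 z3 :
  layer_path4 k u x1 x2 x3 w -> layer_path4 k u y1 y2 y3 w ->
  layer_path4 k u z1 z2 z3 w ->
  uniq [:: x1; y1; z1] -> color u x1 = color x3 w.
Proof.
move=> px py pz U; have /andP[/= /andP[/and3P[ku _ _] _] _] := px.
case/orP: ku => /eqP ku.
- rewrite -(color_setC u) -(color_setC x3).
  apply: (zigzag_theta (layer_path4_high px ku) (layer_path4_high py ku)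
                       (layer_path4_high pz ku)).
  by rewrite -(map_inj_uniq (@setC_inj _)) /= !setCK.
- exact: (zigzag_theta (layer_path4_low px ku) (layer_path4_low py ku)
                       (layer_path4_low pz ku)).
Qed.

End Colours.

(** * The graph *)

(** The 8-cycle, the path from 0 to 4 and the path from 1 to 5. *)
Definition arcs : seq (nat * nat) :=
  [:: (0, 1); (1, 2); (2, 3); (3, 4); (4, 5); (5, 6); (6, 7); (7, 0);
      (0, 8); (8, 9); (9, 10); (10, 4);
      (1, 11); (11, 12); (12, 13); (13, 5)].

(** Adjacency of vertex numbers; the graph is defined through it so that finite
    checks can be done by computation on natural numbers. *)
Definition arc_adj : rel nat :=
  fun x y => ((x, y) \in arcs) || ((y, x) \in arcs).

Lemma arc_adj_sym : symmetric arc_adj.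
Proof. by move=> x y; rewrite /arc_adj orbC. Qed.

Lemma arc_adj_lt x y : arc_adj x y -> (x < 14) && (y < 14).
Proof.
have /allP arcs_lt : all (fun a => (a.1 < 14) && (a.2 < 14)) arcs by [].
by case/orP=> /arcs_lt //=; rewrite andbC.
Qed.

Lemma arc_adj_irrefl : irreflexive arc_adj.
Proof.
move=> x; apply/negP; rewrite /arc_adj orbb => xx.
have /allP/(_ _ xx) : all (fun a => a.1 != a.2) arcs by [].
by rewrite /= eqxx.
Qed.

Definition double_theta_adj : rel 'I_14 := fun x y => arc_adj x y.

Lemma double_theta_adj_sym : symmetric double_theta_adj.
Proof. by move=> x y; apply: arc_adj_sym. Qed.

Lemma double_theta_adj_irrefl : irreflexive double_theta_adj.
Proof. by move=> x; apply: arc_adj_irrefl. Qed.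

(** The 8-cycle with two further paths: two interlocking theta graphs, one with
    branch vertices 0 and 4, the other with branch vertices 1 and 5. *)
Definition double_theta : sgraph := SGraph double_theta_adj_sym double_theta_adj_irrefl.

(** * It is cubical *)

(** The vertices as subsets of {0, 1, 2, 3}, in the order of their numbers: first the
    8-cycle, then the inner vertices of the path from 0 to 4, which is obtained
    by adding the elements 1, 3, 0, 2 in this order, and those of the path from
    1 to 5, where the elements 2, 0, 1, 3 are switched. *)
Definition labels : seq (seq nat) :=
  [:: [::]; [:: 0]; [:: 0; 1]; [:: 0; 1; 2]; [:: 0; 1; 2; 3]; [:: 1; 2; 3];
      [:: 2; 3]; [:: 3];
      [:: 1]; [:: 1; 3]; [:: 0; 1; 3];
      [:: 0; 2]; [:: 2]; [:: 1; 2]].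

Definition label (x : nat) : seq nat := nth [::] labels x.

(** The elements of [s] below [n], as a subset of ['I_n]. *)
Definition set_of_seq n (s : seq nat) : {set 'I_n} := [set i | val i \in s].

Lemma set_of_seq_inj n s t :
  sorted ltn s -> sorted ltn t -> all (gtn n) s -> all (gtn n) t ->
  set_of_seq n s = set_of_seq n t -> s = t.
Proof.
move=> s_sorted t_sorted /allP s_lt /allP t_lt /setP est.
apply: (irr_sorted_eq ltn_trans ltnn) => // i.
have [lt_in|ge_in] := ltnP i n; first by have := est (Ordinal lt_in); rewrite !inE.
by apply/idP/idP => [/s_lt|/t_lt] /=; rewrite ltnNge ge_in.
Qed.

Lemma card_set_of_seq n s : uniq s -> all (gtn n) s -> #|set_of_seq n s| = size s.
Proof.
move=> s_uniq /allP s_lt; rewrite cardE -(size_map val); apply/perm_size.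
apply: uniq_perm => //; first by rewrite (map_inj_uniq val_inj) enum_uniq.
move=> i; apply/mapP/idP => [[j]|si]; first by rewrite mem_enum inE => sj ->.
by exists (Ordinal (s_lt i si)); rewrite // mem_enum inE.
Qed.

Lemma cover_set_of_seq n s t : uniq s -> uniq t -> all (gtn n) s -> all (gtn n) t ->
  all (mem t) s -> size t = (size s).+1 ->
  cover_rel (set_of_seq n s) (set_of_seq n t).
Proof.
move=> s_uniq t_uniq s_lt t_lt /allP s_t st.
rewrite /cover_rel !card_set_of_seq // st eqxx andbT.
by apply/subsetP=> i; rewrite !inE => /s_t.
Qed.

Lemma labelP x : sorted ltn (label x) && all (gtn 4) (label x).
Proof.
have /all_nthP L : all (fun s => sorted ltn s && all (gtn 4) s) labels by [].
have [/L|ge_x] := ltnP x (size labels); first exact.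
by rewrite /label nth_default.
Qed.

Lemma double_theta_cubical : cubical double_theta.
Proof.
apply: (@cubical_of_embedding double_theta 4
          (fun x : 'I_14 => set_of_seq 4 (label x))).
  move=> x y /set_of_seq_inj e; apply/val_inj/eqP; move: e.
  have [/andP[sx lx] /andP[sy ly]] := (labelP (val x), labelP (val y)).
  move=> /(_ sx sy lx ly)/eqP; rewrite nth_uniq ?ltn_ord //.
move=> x y /=; rewrite /double_theta_adj; move: (val x) (val y) => {x y} x y.
pose below (s t : seq nat) := all (mem t) s && (size t == (size s).+1).
have label_arc a : a \in arcs ->
    below (label a.1) (label a.2) || below (label a.2) (label a.1).
  by move: a; apply/allP.
have coverP a b : below (label a) (label b) ->
    cover_rel (set_of_seq 4 (label a)) (set_of_seq 4 (label b)).
  have [/andP[sa la] /andP[sb lb]] := (labelP a, labelP b).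
  case/andP=> ab /eqP cab; apply: cover_set_of_seq => //;
    exact: (sorted_uniq ltn_trans ltnn).
rewrite /cube_adj => /orP[] /label_arc /orP[] /coverP -> //; exact: orbT.
Qed.

(** * It has girth 8 *)

(** The neighbours of [x]. *)
Definition nbrs (x : nat) : seq nat := [seq y <- iota 0 14 | arc_adj x y].

Lemma mem_nbrs x y : (y \in nbrs x) = arc_adj x y.
Proof.
rewrite mem_filter mem_iota; case: (boolP (arc_adj x y)) => //.
by case/arc_adj_lt/andP.
Qed.

(** The walks with [m] steps starting from the vertex [x]; each is listed without
    its starting point. *)
Fixpoint walks m (x : nat) : seq (seq nat) :=
  if m is m'.+1 then
    flatten [seq [seq y :: p | p <- walks m' y] | y <- nbrs x]
  else [:: [::]].

Lemma mem_walks x p : path arc_adj x p -> p \in walks (size p) x.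
Proof.
elim: p x => [//|y p IHp] x /andP[xy /IHp yp].
apply/flatten_mapP; exists y; last exact: map_f.
by rewrite mem_nbrs.
Qed.

Lemma no_short_cycle x p :
  x < 14 -> 1 < size p < 7 -> uniq (x :: p) -> ~~ cycle arc_adj (x :: p).
Proof.
move=> lt_x /andP[gt_p lt_p] Uxp; apply/negP => Cxp.
have wp : p \in walks (size p) x.
  by apply: mem_walks; move: Cxp; rewrite /= rcons_path => /andP[].
have /allP/(_ (size p)) : all (fun m => all (fun y => all
    (fun q => ~~ (uniq (y :: q) && cycle arc_adj (y :: q))) (walks m y))
    (iota 0 14)) (iota 2 5) by vm_compute.
rewrite mem_iota gt_p lt_p => /(_ isT)/allP/(_ x); rewrite mem_iota lt_x.
move=> /(_ isT)/allP/(_ p wp); by rewrite Uxp Cxp.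
Qed.

Lemma double_theta_girth : has_girth double_theta 8.
Proof.
split.
  exists [:: @Ordinal 14 0 isT; @Ordinal 14 1 isT; @Ordinal 14 2 isT;
             @Ordinal 14 3 isT; @Ordinal 14 4 isT; @Ordinal 14 5 isT;
             @Ordinal 14 6 isT; @Ordinal 14 7 isT].
  by [].
case=> [[]//|x p] [gt2 /andP[Cxp Uxp]]; rewrite leqNgt; apply/negP => lt8.
have := @no_short_cycle (val x) (map val p) (ltn_ord x).
rewrite size_map -ltnS gt2 -[size p < 7]ltnS lt8 -map_cons.
rewrite (map_inj_uniq val_inj) Uxp => /(_ isT isT)/negP; apply.
by rewrite cycle_map.
Qed.

(** * It is not layered *)

Lemma double_theta_not_layered : ~ layered double_theta.
Proof.
case/layered_embedding=> n [k [f [f_inj f_adj]]].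
pose v i := f (inord i : 'I_14).
have v_inj : {in gtn 14 &, injective v}.
  move=> i j; rewrite !inE => lt_i lt_j /f_inj/(congr1 val) /=.
  by rewrite !inordK.
have v_adj i j : arc_adj i j -> layer_adj k (v i) (v j).
  move=> ij; apply: f_adj; have /andP[lt_i lt_j] := arc_adj_lt ij.
  by rewrite /= /double_theta_adj /= !inordK.
have v_uniq s : all (gtn 14) s -> uniq s -> uniq (map v s).
  move=> /allP s_lt s_uniq; rewrite map_inj_in_uniq // => i j si sj.
  by apply: v_inj; apply: s_lt.
have v_path i a b c j : path arc_adj i [:: a; b; c; j] ->
    all (gtn 14) [:: i; a; b; c; j] -> uniq [:: i; a; b; c; j] ->
    layer_path4 k (v i) (v a) (v b) (v c) (v j).
  move=> p lt u; apply/andP; split; last exact: (v_uniq _ lt u).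
  rewrite -[_ :: _]/(map v [:: a; b; c; j]) path_map.
  by apply: sub_path p => ? ?; apply: v_adj.
have v_neq i j : i < 14 -> j < 14 -> i != j -> v i != v j.
  by move=> lt_i lt_j; apply: contraNneq => /v_inj->.
have v_cube i j : arc_adj i j -> cube_adj (v i) (v j).
  by move=> /v_adj/and3P[].
have v_consec i j l c : arc_adj i j -> arc_adj j l -> i < 14 -> l < 14 -> i != l ->
    c \in color (v i) (v j) -> c \notin color (v j) (v l).
  by move=> ij jl lt_i lt_l il; apply: color_consecutive; auto.
(* The three paths from 0 to 4 and the three paths from 1 to 5. *)
have p04 := v_path 0 1 2 3 4 isT isT isT.
have q04 := v_path 0 7 6 5 4 isT isT isT.
have r04 := v_path 0 8 9 10 4 isT isT isT.
have p15 := v_path 1 2 3 4 5 isT isT isT.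
have q15 := v_path 1 0 7 6 5 isT isT isT.
have r15 := v_path 1 11 12 13 5 isT isT isT.
have E14 := theta_color p04 q04 r04 (v_uniq [:: 1; 7; 8] isT isT).
have E85 := theta_color q04 p04 r04 (v_uniq [:: 7; 1; 8] isT isT).
have E25 := theta_color p15 q15 r15 (v_uniq [:: 2; 0; 11] isT isT).
have E16 := theta_color q15 p15 r15 (v_uniq [:: 0; 2; 11] isT isT).
have [c E2] := color_adj (v_cube 1 2 isT).
have c2 : c \in color (v 1) (v 2) by rewrite E2 set11.
have c5 : c \in color (v 4) (v 5) by rewrite -E25.
have c8 : c \in color (v 0) (v 7) by rewrite E85 colorC.
have c1 : c \notin color (v 1) (v 0).
  by apply: (v_consec 2 1 0) => //; rewrite colorC.
have c3 : c \notin color (v 2) (v 3) by apply: (v_consec 1 2 3).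
have c4 : c \notin color (v 3) (v 4) by rewrite -E14 colorC.
have c6 : c \notin color (v 6) (v 5) by rewrite -E16.
have c7 : c \notin color (v 7) (v 6) by apply: (v_consec 0 7 6).
(* The colour [c] occurs three times around the 8-cycle. *)
move: c1 c2 c3 c4 c5 c6 c7 c8; rewrite !in_color.
by do 8 case: (c \in _).
Qed.

Theorem theorem3 :
  exists G : sgraph, cubical G /\ has_girth G 8 /\ ~ layered G.
Proof.
exists double_theta; split; first exact: double_theta_cubical.
split; [exact: double_theta_girth | exact: double_theta_not_layered].
Qed.
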